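(* Let $m\in\mathbb{N}$, let $a_1,\ldots,a_m\ge 0$ be real numbers, and let $f(x)=1+2\sum_{k=1}^m a_k\cos(2k\pi x)$. For $n\in\mathbb{N}$ let $A^{(n)}$ be the $n\times n$ real symmetric matrix representing the compression of multiplication by $f$ to the span of $e_0,\ldots,e_{n-1}$, i.e. $A^{(n)}_{jk}=\int_0^1 f(x)e_{j-1}(x)e_{k-1}(x)\,dx$ for $1\le j,k\le n$, where $e_0=1$ and $e_i(x)=\sqrt2\cos(2i\pi x)$ for $i\ge1$. Assume that (i) there are $m'\le m$ and a positive semidefinite real symmetric $(m'+1)\times(m'+1)$ matrix $B$ such that $f=v^TBv$, where $v^T=\begin{pmatrix}1&\cos(2\pi x)&\cdots&\cos(2m'\pi x)\end{pmatrix}$; (ii) $\operatorname{tr}(A^{(5)}H)<0$, where $H$ is the Horn matrix. Then for every $n\ge5$ the matrix $A^{(n)}$ is doubly nonnegative but not completely positive.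
   Context: A real symmetric $n\times n$ matrix is doubly nonnegative if it is positive semidefinite and all its entries are nonnegative. It is completely positive if it equals $BB^T$ for some $r\in\mathbb{N}$ and some $n\times r$ matrix $B$ with nonnegative entries. The Horn matrix is $$H=\begin{pmatrix}1&-1&1&1&-1\\-1&1&-1&1&1\\1&-1&1&-1&1\\1&1&-1&1&-1\\-1&1&1&-1&1\end{pmatrix}.$$ The functions $e_0,e_1,e_2,\ldots$ are orthonormal in $L^2[0,1]$ (Lebesgue measure). *)

(* Defs.v *)
From HB Require Import structures.
From mathcomp Require Import all_boot all_order all_algebra.
From mathcomp Require Import all_classical all_reals all_analysis.

Set Implicit Arguments.
Unset Strict Implicit.
Unset Printing Implicit Defensive.

Import Order.TTheory GRing.Theory Num.Theory.
Import numFieldNormedType.Exports.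

Local Open Scope ring_scope.
Local Open Scope classical_set_scope.

Definition psdmx (R : realType) (n : nat) (A : 'M[R]_n) : Prop :=
  A \is symmetricmx /\ forall x : 'cV[R]_n, 0 <= (x^T *m A *m x) 0 0.

Definition doubly_nonnegative (R : realType) (n : nat) (A : 'M[R]_n) : Prop :=
  psdmx A /\ forall i j, 0 <= A i j.

Definition completely_positive (R : realType) (n : nat) (A : 'M[R]_n) : Prop :=
  exists (r : nat) (B : 'M[R]_(n, r)),
    (forall i j, 0 <= B i j) /\ A = B *m B^T.

Definition horn (R : realType) : 'M[R]_5 :=
  \matrix_(i, j) nth 0 (nth [::]
    [:: [::  1; -1;  1;  1; -1];
        [:: -1;  1; -1;  1;  1];
        [::  1; -1;  1; -1;  1];
        [::  1;  1; -1;  1; -1];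
        [:: -1;  1;  1; -1;  1]] i) j.

Definition cosine_basis (R : realType) (i : nat) (x : R) : R :=
  if i == 0%N then 1 else Num.sqrt 2 * cos (2 * i%:R * pi * x).

Definition cosine_poly (R : realType) (m : nat) (a : nat -> R) (x : R) : R :=
  1 + 2 * \sum_(1 <= k < m.+1) a k * cos (2 * k%:R * pi * x).

(* Ordinal indices start at 0: entry (j, k) is the integral of f e_j e_k. *)
Definition compression (R : realType) (f : R -> R) (n : nat) : 'M[R]_n :=
  \matrix_(j < n, k < n)
    \int[@lebesgue_measure R]_(x in `[0, 1])
      (f x * cosine_basis j x * cosine_basis k x).

Definition cosine_vec (R : realType) (m : nat) (x : R) : 'cV[R]_m.+1 :=
  \col_(i < m.+1) cos (2 * i%:R * pi * x).

(* Main.v *)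
(** The quadratic form of [A^(n)] at [v] is the integral of
    [f * (sum_i v_i e_i)^2], and [f >= 0] by (i).  The entries are nonnegative
    because a product of three cosines of integer frequency is an average of
    such cosines, each of integral 0 or 1.  A completely positive [A^(n)] would
    have a completely positive leading block [A^(5)], whose trace against the
    Horn matrix, being copositive, is nonnegative; this contradicts (ii). *)
Require Import Defs.
From HB Require Import structures.
From mathcomp Require Import all_boot all_order all_algebra.
From mathcomp Require Import all_classical all_reals all_analysis.
From mathcomp Require Import ring.

Set Implicit Arguments.
Unset Strict Implicit.
Unset Printing Implicit Defensive.

Import Order.TTheory GRing.Theory Num.Theory.
Import numFieldNormedType.Exports.

Local Open Scope ring_scope.
Local Open Scope classical_set_scope.

(** * The Horn matrix against completely positive matrices *)

Lemma horn_copositive (R : realType) (x : 'cV[R]_5) :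
  (forall i, 0 <= x i 0) -> 0 <= (x^T *m horn R *m x) 0 0.
Proof.
move=> x_ge0.
set a := x (inord 0) 0; set b := x (inord 1) 0; set c := x (inord 2) 0.
set d := x (inord 3) 0; set e := x (inord 4) 0.
have -> : (x^T *m horn R *m x) 0 0 =
    a * (a - b + c + d - e) + b * (- a + b - c + d + e) +
    c * (a - b + c - d + e) + d * (a + b - c + d - e) +
    e * (- a + b + c - d + e).
  (* Read off a list, the coordinates compute to [a], ..., [e] once the sums over ['I_5] are
     unrolled, which leaves a goal for [ring]. *)
  have xE i : x i 0 = nth 0 [:: a; b; c; d; e] i.
    by case: i => -[|[|[|[|[|//]]]]] i_lt5 /=;
      congr (x _ _); apply: val_inj; rewrite /= inordK.
  rewrite -mulmxA mxE.
  under eq_bigr => i _.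
    rewrite !mxE.
    under eq_bigr => j _ do rewrite mxE xE.
    rewrite xE; over.
  by rewrite !big_ord_recl !big_ord0 /=; ring.
have [a0 b0 c0 d0 e0] : [/\ 0 <= a, 0 <= b, 0 <= c, 0 <= d & 0 <= e].
  by split; apply: x_ge0.
(* Copositivity: each of the two decompositions below, square plus products,
   is valid on one side of [d <= e]. *)
have [le_de|/ltW le_ed] := leP d e.
  have -> : a * (a - b + c + d - e) + b * (- a + b - c + d + e) +
      c * (a - b + c - d + e) + d * (a + b - c + d - e) +
      e * (- a + b + c - d + e) =
      (a - b + c + d - e) ^+ 2 + 4 * (b * d + c * (e - d)) by ring.
  by rewrite addr_ge0 ?sqr_ge0// mulr_ge0// addr_ge0 ?mulr_ge0 ?subr_ge0.
have -> : a * (a - b + c + d - e) + b * (- a + b - c + d + e) +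
    c * (a - b + c - d + e) + d * (a + b - c + d - e) +
    e * (- a + b + c - d + e) =
    (a - b + c - d + e) ^+ 2 + 4 * (b * e + a * (d - e)) by ring.
by rewrite addr_ge0 ?sqr_ge0// mulr_ge0// addr_ge0 ?mulr_ge0 ?subr_ge0.
Qed.

(** The rows of the factor [B] selected by [g] factor the submatrix. With the embedding of the first
    five indices as [g], this gives the leading block. *)
Lemma completely_positive_mxsub (R : realType) (n p : nat) (A : 'M[R]_n)
  (g : 'I_p -> 'I_n) :
  completely_positive A -> completely_positive (mxsub g g A).
Proof.
move=> [r [B [B_ge0 ->]]]; exists r, (rowsub g B); split=> [i j|].
  by rewrite mxE.
by apply/matrixP => i j; rewrite !mxE; apply: eq_bigr => k _; rewrite !mxE.
Qed.

(** Cyclicity turns the trace of $BB^TH$ into that of $B^THB$, whose diagonal entries are the values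
    of the Horn form at the nonnegative columns of [B]. *)
Lemma completely_positive_horn_ge0 (R : realType) (A : 'M[R]_5) :
  completely_positive A -> 0 <= \tr (A *m horn R).
Proof.
move=> [r [B [B_ge0 ->]]]; rewrite -mulmxA mxtrace_mulC.
apply: sumr_ge0 => k _.
have -> : (B^T *m horn R *m B) k k = ((col k B)^T *m horn R *m col k B) 0 0.
  rewrite tr_col -row_mul !mxE; apply: eq_bigr => i _.
  by rewrite !mxE.
by apply: horn_copositive => i; rewrite mxE.
Qed.

(** * Integrals of continuous functions over the unit interval *)

Section UnitIntervalIntegral.
Variable R : realType.
Implicit Types f g : R -> R.

Definition unit_integral f : R := \int[@lebesgue_measure R]_(x in `[0, 1]) f x.

Lemma continuous_integrable_unit f : continuous f ->
  (@lebesgue_measure R).-integrable `[0, 1] (EFin \o f).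
Proof.
move=> f_cont; apply: continuous_compact_integrable.
  exact: segment_compact.
exact: continuous_subspaceT.
Qed.

Lemma unit_integral_ge0 f :
  (forall x, 0 <= x <= 1 -> 0 <= f x) -> 0 <= unit_integral f.
Proof.
by move=> f_ge0; apply: Rintegral_ge0 => x /=; rewrite in_itv /=; apply: f_ge0.
Qed.

Lemma unit_integralD f g : continuous f -> continuous g ->
  unit_integral (fun x => f x + g x) = unit_integral f + unit_integral g.
Proof.
move=> f_cont g_cont; rewrite /unit_integral RintegralD//;
  exact: continuous_integrable_unit.
Qed.

Lemma unit_integralZ f c : continuous f ->
  unit_integral (fun x => c * f x) = c * unit_integral f.
Proof.
move=> f_cont; rewrite /unit_integral RintegralZl//;
  exact: continuous_integrable_unit.
Qed.

Lemma continuous_sum_fun (I : Type) (s : seq I) (F : I -> R -> R) :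
  (forall i, continuous (F i)) -> continuous (fun x => \sum_(i <- s) F i x).
Proof.
move=> F_cont; elim: s => [|i s IHs] x.
  by under eq_fun do rewrite big_nil; apply: cvg_cst.
under eq_fun do rewrite big_cons.
exact: (continuousD (F_cont i x) (IHs x)).
Qed.

Lemma unit_integral_sum (I : Type) (s : seq I) (F : I -> R -> R) :
  (forall i, continuous (F i)) ->
  unit_integral (fun x => \sum_(i <- s) F i x) =
  \sum_(i <- s) unit_integral (F i).
Proof.
move=> F_cont; elim: s => [|i s IHs].
  rewrite big_nil; under eq_fun do rewrite big_nil.
  by rewrite /unit_integral Rintegral_cst//= mul0r.
under eq_fun do rewrite big_cons.
rewrite big_cons unit_integralD ?IHs//.
exact: continuous_sum_fun.
Qed.

Lemma continuous_mul_fun f g : continuous f -> continuous g ->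
  continuous (fun x => f x * g x).
Proof. by move=> f_cont g_cont x; exact: (continuousM (f_cont x) (g_cont x)). Qed.

Lemma continuous_scale_fun c f : continuous f -> continuous (fun x => c * f x).
Proof. by apply: continuous_mul_fun => x; apply: cvg_cst. Qed.

Lemma continuous_cos_freq (w : R) : continuous (fun x => cos (w * x)).
Proof.
move=> x; apply: (continuous_comp (f := fun y : R => w * y) (g := cos)).
  exact: mulrl_continuous.
exact: continuous_cos.
Qed.

(** * Integrals of cosines of integer frequency and of their products *)

Lemma sin_2pi_int (z : int) : sin (2 * z%:~R * pi) = 0 :> R.
Proof.
suff sin_nat (n : nat) : sin (2 * n%:R * pi) = 0 :> R.
  case: z => n; first exact: sin_nat.
  by rewrite NegzE mulrNz mulrN mulNr sinN sin_nat oppr0.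
have -> : 2 * n%:R * pi = 0 + pi *+ 2 *+ n :> R.
  by rewrite -[_ *+ n]mulr_natr -mulr_natr; ring.
by rewrite (periodicn (@sinD2pi R)) sin0.
Qed.

(** Fundamental theorem of calculus with antiderivative $\sin(wx)/w$, which vanishes at 0. *)
Lemma unit_integral_cos (w : R) : w != 0 ->
  unit_integral (fun x => cos (w * x)) = sin w / w.
Proof.
move=> w_neq0.
have dF (x : R) : is_derive x 1 (fun y => sin (w * y) / w) (cos (w * x)).
  by apply: is_derive_eq; rewrite scaler0 add0r /GRing.scale /=; field.
have F_cont : continuous (fun x => sin (w * x) / w).
  move=> x; apply/differentiable_continuous/derivable1_diffP.
  by have [] := dF x.
rewrite /unit_integral /Rintegral (@continuous_FTC2 R _ (fun y => sin (w * y) / w)).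
- by rewrite -EFinB /= mulr1 mulr0 sin0 mul0r subr0.
- exact: ltr01.
- by apply: continuous_subspaceT; apply: continuous_cos_freq.
(* [continuous_FTC2] asks for derivability inside the interval and one-sided continuity at the
   endpoints 0 and 1. *)
- split.
  + by move=> x _; have [] := dF x.
  + exact: cvg_at_right_filter (F_cont 0).
  + exact: cvg_at_left_filter (F_cont 1).
- by move=> x _; rewrite derive1E; have [] := dF x.
Qed.

(** Integer frequencies make the family closed under the differences produced by product-to-sum
    formulas; subtraction on [nat] would truncate. *)
Definition cosz (z : int) (x : R) : R := cos (2 * z%:~R * pi * x).

Lemma continuous_cosz z : continuous (cosz z).
Proof. exact: continuous_cos_freq. Qed.

Lemma cosz_mul z1 z2 x :
  cosz z1 x * cosz z2 x = 2^-1 * (cosz (z1 - z2) x + cosz (z1 + z2) x).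
Proof.
rewrite /cosz intrB intrD.
rewrite (_ : 2 * (z1%:~R - z2%:~R) * pi * x =
  2 * z1%:~R * pi * x - 2 * z2%:~R * pi * x); last by ring.
rewrite (_ : 2 * (z1%:~R + z2%:~R) * pi * x =
  2 * z1%:~R * pi * x + 2 * z2%:~R * pi * x); last by ring.
by rewrite cosB cosD; field.
Qed.

(** The integrand is 1 for [z = 0]; otherwise the integral is a multiple of $\sin(2\pi z)=0$. *)
Lemma unit_integral_cosz_ge0 z : 0 <= unit_integral (cosz z).
Proof.
have [->|z_neq0] := eqVneq z 0.
  apply: unit_integral_ge0 => x _.
  by rewrite /cosz mulr0z mulr0 !mul0r cos0 ler01.
rewrite unit_integral_cos ?sin_2pi_int ?mul0r//.
by rewrite !mulf_neq0 ?pnatr_eq0 ?intr_eq0 ?(gt_eqF (pi_gt0 R)).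
Qed.

(** Applying [cosz_mul] twice makes the product the average of the four cosines of frequencies
    $z_1\pm z_2\pm z_3$. *)
Lemma unit_integral_cosz3_ge0 z1 z2 z3 :
  0 <= unit_integral (fun x => cosz z1 x * cosz z2 x * cosz z3 x).
Proof.
have -> : (fun x => cosz z1 x * cosz z2 x * cosz z3 x) =
    (fun x => 4^-1 * \sum_(z <- [:: z1 - z2 - z3; z1 - z2 + z3;
                                    z1 + z2 - z3; z1 + z2 + z3]) cosz z x).
  apply/funext => x; rewrite cosz_mul -mulrA mulrDl !cosz_mul.
  by rewrite !big_cons big_nil; field.
rewrite unit_integralZ; last exact: continuous_sum_fun continuous_cosz.
rewrite mulr_ge0 ?invr_ge0// unit_integral_sum; last exact: continuous_cosz.
by apply: sumr_ge0 => z _; apply: unit_integral_cosz_ge0.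
Qed.

End UnitIntervalIntegral.

(** * Entrywise nonnegativity of the compressions *)

(** With the normalising constant split off, the constant function $e_0$ is the case of frequency 0
    of a single formula. *)
Definition cosine_weight (R : realType) (i : nat) : R :=
  if i == 0 then 1 else Num.sqrt 2.

Lemma cosine_weight_ge0 (R : realType) i : 0 <= cosine_weight R i.
Proof. by rewrite /cosine_weight; case: ifP => // _; apply: sqrtr_ge0. Qed.

Lemma cosine_basisE (R : realType) i (x : R) :
  cosine_basis i x = cosine_weight R i * cosz i%:Z x.
Proof.
rewrite /cosine_basis /cosine_weight /cosz; case: eqP => [->|//].
by rewrite mulr0 !mul0r cos0 mulr1.
Qed.

Lemma continuous_cosine_basis (R : realType) i : continuous (@cosine_basis R i).
Proof.
have -> : @cosine_basis R i = (fun x => cosine_weight R i * cosz i%:Z x).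
  by apply/funext => x; rewrite cosine_basisE.
exact/continuous_scale_fun/continuous_cosz.
Qed.

(** The constant term is absorbed as frequency 0, where the coefficient is 1 and not [2 * a 0]. *)
Lemma cosine_polyE (R : realType) m (a : nat -> R) x :
  cosine_poly m a x =
  \sum_(k < m.+1) (if k == 0 :> nat then 1 else 2 * a k) * cosz k%:Z x.
Proof.
rewrite /cosine_poly big_ord_recl /= {1}/cosz mulr0 !mul0r cos0 mulr1.
congr (_ + _); rewrite mulr_sumr big_add1 /= big_mkord.
by apply: eq_bigr => k _; rewrite mulrA.
Qed.

Lemma continuous_cosine_poly (R : realType) m (a : nat -> R) :
  continuous (cosine_poly m a).
Proof.
rewrite (funext (cosine_polyE m a)).
by apply: continuous_sum_fun => k; apply/continuous_scale_fun/continuous_cosz.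
Qed.

Lemma compression_ge0 (R : realType) m (a : nat -> R) n i j :
  (forall k : nat, (1 <= k <= m)%N -> 0 <= a k) ->
  0 <= compression (cosine_poly m a) n i j.
Proof.
move=> a_ge0; rewrite mxE -/(unit_integral _).
have -> : (fun x => cosine_poly m a x * cosine_basis i x * cosine_basis j x) =
    (fun x => \sum_(k < m.+1) (if k == 0 :> nat then 1 else 2 * a k) *
        (cosine_weight R i * cosine_weight R j) *
        (cosz k%:Z x * cosz i%:Z x * cosz j%:Z x)).
  apply/funext => x; rewrite cosine_polyE !cosine_basisE -mulrA mulr_suml.
  by apply: eq_bigr => k _; ring.
have cos3_cont k : continuous (fun x : R => cosz k%:Z x * cosz i%:Z x * cosz j%:Z x).
  by do !apply: continuous_mul_fun; apply: continuous_cosz.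
rewrite unit_integral_sum => [|k]; last exact: continuous_scale_fun.
apply: sumr_ge0 => k _; rewrite unit_integralZ//.
rewrite !mulr_ge0 ?cosine_weight_ge0 ?unit_integral_cosz3_ge0//.
(* Only the coefficient of [f] remains: it is 1 at [k = 0], and otherwise [k] lies between 1 and
   [m], where [a k] is nonnegative. *)
case: eqP => // /eqP; rewrite -lt0n => k_gt0.
by rewrite mulr_ge0// a_ge0// k_gt0 -ltnS /=.
Qed.

(** * Positive semidefiniteness and the conclusion *)

Lemma compression_psd (R : realType) (f : R -> R) n :
  continuous f -> (forall x, 0 <= x <= 1 -> 0 <= f x) ->
  psdmx (compression f n).
Proof.
move=> f_cont f_ge0; split.
  (* Symmetric means hermitian with sign exponent 0 and trivial conjugation, so equality with the
     transpose is left. *)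
  apply/is_hermitianmxP; rewrite expr0 scale1r.
  apply/matrixP => i j; rewrite !mxE /=.
  by apply: eq_Rintegral => x _; rewrite mulrAC.
move=> v.
have ent_cont (i j : nat) : continuous (fun x : R => f x * cosine_basis i x * cosine_basis j x).
  by do !apply: continuous_mul_fun => //; apply: continuous_cosine_basis.
have -> : (v^T *m compression f n *m v) 0 0 =
    unit_integral (fun x => \sum_(i < n) \sum_(j < n)
      (v i 0 * v j 0) * (f x * cosine_basis i x * cosine_basis j x)).
  have ent_contZ (i j : 'I_n) : continuous (fun x : R =>
      (v i 0 * v j 0) * (f x * cosine_basis i x * cosine_basis j x)).
    exact: continuous_scale_fun.
  rewrite unit_integral_sum => [|i]; last exact: continuous_sum_fun.
  rewrite -mulmxA mxE; apply: eq_bigr => i _.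
  rewrite unit_integral_sum// !mxE mulr_sumr; apply: eq_bigr => j _.
  by rewrite unit_integralZ// !mxE /unit_integral; ring.
apply: unit_integral_ge0 => x x01.
(* Pointwise, the double sum is [f x] times the expanded square of $\sum_i v_ie_i(x)$. *)
have -> : \sum_(i < n) \sum_(j < n)
      (v i 0 * v j 0) * (f x * cosine_basis i x * cosine_basis j x) =
    f x * (\sum_(i < n) v i 0 * cosine_basis i x) ^+ 2.
  rewrite expr2 big_distrlr /= mulr_sumr; apply: eq_bigr => i _.
  by rewrite mulr_sumr; apply: eq_bigr => j _; ring.
by rewrite mulr_ge0 ?f_ge0 ?sqr_ge0.
Qed.

Theorem mainTheorem1 (R : realType) (m : nat) (a : nat -> R)
  (a_ge0 : forall k : nat, (1 <= k <= m)%N -> 0 <= a k)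
  (f_sos : exists (m' : nat) (B : 'M[R]_m'.+1),
    [/\ (m' <= m)%N, psdmx B &
        forall x : R, 0 <= x <= 1 ->
          cosine_poly m a x =
            ((cosine_vec m' x)^T *m B *m cosine_vec m' x) 0 0])
  (tr_lt0 : \tr (compression (cosine_poly m a) 5 *m horn R) < 0) :
  forall n : nat, (5 <= n)%N ->
    doubly_nonnegative (compression (cosine_poly m a) n) /\
    ~ completely_positive (compression (cosine_poly m a) n).
Proof.
move=> n le5n; split.
  split; last by move=> i j; apply: compression_ge0.
  apply: compression_psd; first exact: continuous_cosine_poly.
  by case: f_sos => m' [B [_ [_ B_ge0] fE]] x /fE ->; apply: B_ge0.
move=> /(completely_positive_mxsub (widen_ord le5n)).
(* An entry of the compression depends on its two indices but not on [n], so the leading block is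
   the matrix of the trace hypothesis. *)
have -> : mxsub (widen_ord le5n) (widen_ord le5n)
    (compression (cosine_poly m a) n) = compression (cosine_poly m a) 5.
  by apply/matrixP => i j; rewrite !mxE.
by move/completely_positive_horn_ge0; rewrite leNgt tr_lt0.
Qed.
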